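(* Let $G_0$ be the connected component of the identity of $\mathsf{GL}(2,\mathbb{R})$, with Lie algebra $\mathfrak{g}=\mathfrak{gl}(2,\mathbb{R})$. Let $k^+$ be the bi-invariant Lorentzian metric on $G_0$ determined by $k(u,v)=\mathrm{trace}(u\circ v)$, and let $\nabla$ be the flat, torsion-free bi-invariant connection on $G_0$ determined by $\nabla_{u^+}v^+=(u\circ v)^+$ for $u,v\in\mathfrak{g}$. Then $(G_0,\nabla,k^+)$ is a local, in fact global, Hessian manifold.
   Context: For $u\in\mathfrak{g}$, $u^+$ denotes the left-invariant vector field on $G_0$ with value $u$ at the identity; $k^+$ is the semi-Riemannian metric with $k^+(u^+,v^+)=k(u,v)$; $u\circ v$ is the matrix product. Let $M$ be a manifold with a flat torsion-free connection $\nabla$ and a semi-Riemannian metric $g$. The triple $(M,\nabla,g)$ is a (local) Hessian manifold if every point has a neighbourhood $U$ with a smooth function $f:U\to\mathbb{R}$ such that $g=\nabla df$ on $U$, i.e. $g_{ij}=\frac{\partial^2 f}{\partial x_i\partial x_j}$ in local affine coordinates of $\nabla$; it is globally Hessian if there is such a potential function $f$ defined on all of $M$. *)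

(* Defs.v *)
From HB Require Import structures.
From mathcomp Require Import all_boot all_order all_algebra.
From mathcomp Require Import all_classical all_reals all_analysis.

Set Implicit Arguments.
Unset Strict Implicit.
Unset Printing Implicit Defensive.

Import Order.TTheory GRing.Theory Num.Theory.
Import numFieldNormedType.Exports.

Local Open Scope classical_set_scope.
Local Open Scope ring_scope.

(** Manifolds are open subsets [M] of a space [E = 'M[R]_(m.+1, n.+1)] of
    matrices, with every tangent space identified with [E].  Functions, vector
    fields and tensor fields on [M] are total functions on [E] of which only the
    values on [M] matter: [nabla X Y x] is the value at [x] of the covariant
    derivative of [Y] along [X], and [g x v w] that of a (0,2)-tensor field. *)

Notation connection_op V := ((V -> V) -> (V -> V) -> V -> V) (only parsing).
Notation form_field R V := (V -> V -> V -> R) (only parsing).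

(** Over a finite-dimensional [V] and an open [M] this is the usual C^k class. *)
Fixpoint Ck_on (R : realType) (V W : normedModType R) (M : set V) (k : nat)
    (f : V -> W) : Prop :=
  if k is k'.+1 then
    (forall x, M x -> differentiable f x) /\
    (forall v : V, Ck_on M k' (fun x => 'D_v f x))
  else forall x, M x -> {for x, continuous f}.

Definition smooth_on (R : realType) (V W : normedModType R) (M : set V)
    (f : V -> W) : Prop :=
  forall k : nat, Ck_on M k f.

Definition field_deriv (R : realType) (V W : normedModType R) (X : V -> V)
    (f : V -> W) : V -> W :=
  fun x => 'D_(X x) f x.

(** The coordinate expression of the bracket [X, Y] f = X (Y f) - Y (X f). *)
Definition lie_bracket (R : realType) (V : normedModType R) (X Y : V -> V) :
    V -> V :=
  fun x => field_deriv X Y x - field_deriv Y X x.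

Record is_connection (R : realType) (V : normedModType R) (M : set V)
    (nabla : connection_op V) : Prop := IsConnection {
  (* [nabla] is well defined on vector fields on [M] *)
  connection_ext : forall X X' Y Y' : V -> V,
    smooth_on M X -> smooth_on M Y ->
    (forall x, M x -> X x = X' x) -> (forall x, M x -> Y x = Y' x) ->
    forall x, M x -> nabla X Y x = nabla X' Y' x;
  connection_smooth : forall X Y : V -> V,
    smooth_on M X -> smooth_on M Y -> smooth_on M (nabla X Y);
  connection_linearl : forall (f : V -> R^o) (X X' Y : V -> V),
    smooth_on M f -> smooth_on M X -> smooth_on M X' -> smooth_on M Y ->
    forall x, M x ->
      nabla (fun y => f y *: X y + X' y) Y x
      = f x *: nabla X Y x + nabla X' Y x;
  connection_addr : forall X Y Y' : V -> V,
    smooth_on M X -> smooth_on M Y -> smooth_on M Y' ->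
    forall x, M x ->
      nabla X (fun y => Y y + Y' y) x = nabla X Y x + nabla X Y' x;
  connection_leibniz : forall (f : V -> R^o) (X Y : V -> V),
    smooth_on M f -> smooth_on M X -> smooth_on M Y ->
    forall x, M x ->
      nabla X (fun y => f y *: Y y) x
      = field_deriv X f x *: Y x + f x *: nabla X Y x }.

Definition torsion_free (R : realType) (V : normedModType R) (M : set V)
    (nabla : connection_op V) : Prop :=
  forall X Y : V -> V, smooth_on M X -> smooth_on M Y ->
  forall x, M x -> nabla X Y x - nabla Y X x = lie_bracket X Y x.

Definition flat (R : realType) (V : normedModType R) (M : set V)
    (nabla : connection_op V) : Prop :=
  forall X Y Z : V -> V, smooth_on M X -> smooth_on M Y -> smooth_on M Z ->
  forall x, M x ->
    nabla X (nabla Y Z) x - nabla Y (nabla X Z) x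
    - nabla (lie_bracket X Y) Z x = 0.

Definition negative_definite_on (R : realType) (V : vectType R)
    (b : V -> V -> R) (W : {vspace V}) : Prop :=
  forall v, v \in W -> v != 0 -> b v v < 0.

(** The index of a symmetric form is the largest dimension of a subspace on
    which it is negative definite. *)
Definition has_index (R : realType) (V : vectType R) (b : V -> V -> R)
    (i : nat) : Prop :=
  (exists2 W : {vspace V}, negative_definite_on b W & \dim W = i) /\
  (forall W : {vspace V}, negative_definite_on b W -> (\dim W <= i)%N).

Record semi_riemannian (R : realType) (m n : nat)
    (M : set 'M[R]_(m.+1, n.+1)) (g : form_field R 'M[R]_(m.+1, n.+1)) :
    Prop := SemiRiemannian {
  metric_linear : forall x, M x -> forall v, scalar (g x v);
  metric_sym : forall x, M x -> forall v w, g x v w = g x w v;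
  metric_nondegenerate : forall x, M x ->
    forall v, (forall w, g x v w = 0) -> v = 0;
  metric_smooth : forall v w, smooth_on M (fun x => g x v w : R^o);
  metric_index : exists i, forall x, M x -> has_index (g x) i }.

Definition lorentzian (R : realType) (m n : nat)
    (M : set 'M[R]_(m.+1, n.+1)) (g : form_field R 'M[R]_(m.+1, n.+1)) : Prop :=
  [/\ semi_riemannian M g, (2 <= m.+1 * n.+1)%N
    & forall x, M x -> has_index (g x) 1].

(** [g = nabla df] on [U], where (nabla df)(X, Y) = X (Y f) - (nabla_X Y) f.  As
    both sides are tensors, it is enough to test them on vector fields defined
    on all of [M]. *)
Definition hessian_potential (R : realType) (V : normedModType R) (M : set V)
    (nabla : connection_op V) (g : form_field R V)
    (U : set V) (f : V -> R^o) : Prop :=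
  smooth_on U f /\
  forall X Y : V -> V, smooth_on M X -> smooth_on M Y ->
  forall x, U x ->
    g x (X x) (Y x)
    = field_deriv X (field_deriv Y f) x - field_deriv (nabla X Y) f x.

Definition flat_metric_manifold (R : realType) (m n : nat)
    (M : set 'M[R]_(m.+1, n.+1))
    (nabla : connection_op 'M[R]_(m.+1, n.+1))
    (g : form_field R 'M[R]_(m.+1, n.+1)) : Prop :=
  [/\ open M, is_connection M nabla, flat M nabla, torsion_free M nabla
    & semi_riemannian M g].

Definition local_hessian (R : realType) (m n : nat)
    (M : set 'M[R]_(m.+1, n.+1))
    (nabla : connection_op 'M[R]_(m.+1, n.+1))
    (g : form_field R 'M[R]_(m.+1, n.+1)) : Prop :=
  flat_metric_manifold M nabla g /\
  forall x, M x -> exists (U : set 'M[R]_(m.+1, n.+1))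
    (f : 'M[R]_(m.+1, n.+1) -> R^o),
    [/\ open U, U x, U `<=` M & hessian_potential M nabla g U f].

Definition global_hessian (R : realType) (m n : nat)
    (M : set 'M[R]_(m.+1, n.+1))
    (nabla : connection_op 'M[R]_(m.+1, n.+1))
    (g : form_field R 'M[R]_(m.+1, n.+1)) : Prop :=
  flat_metric_manifold M nabla g /\
  exists f : 'M[R]_(m.+1, n.+1) -> R^o, hessian_potential M nabla g M f.

Definition GL2 (R : realType) : set 'M[R]_2 := [set x | x \in unitmx].

Definition G0 (R : realType) : set 'M[R]_2 :=
  connected_component (@GL2 R) 1%:M.

(** The differential at 1 of left translation by [x] is [u |-> x *m u]. *)
Definition left_field (R : realType) (u : 'M[R]_2) : 'M[R]_2 -> 'M[R]_2 :=
  fun x => x *m u.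

Definition trace_form (R : realType) (u v : 'M[R]_2) : R := \tr (u *m v).

(** Push-forwards of [X] under left and right translation by [a]. *)
Definition push_left (R : realType) (a : 'M[R]_2) (X : 'M[R]_2 -> 'M[R]_2) :
    'M[R]_2 -> 'M[R]_2 :=
  fun x => a *m X (invmx a *m x).

Definition push_right (R : realType) (a : 'M[R]_2) (X : 'M[R]_2 -> 'M[R]_2) :
    'M[R]_2 -> 'M[R]_2 :=
  fun x => X (x *m invmx a) *m a.

Definition biinvariant_metric (R : realType)
    (g : form_field R 'M[R]_2) : Prop :=
  forall a x, G0 a -> G0 x -> forall v w,
    g (a *m x) (a *m v) (a *m w) = g x v w /\
    g (x *m a) (v *m a) (w *m a) = g x v w.

Definition biinvariant_connection (R : realType)
    (nabla : connection_op 'M[R]_2) : Prop :=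
  forall a X Y, G0 a -> smooth_on (@G0 R) X -> smooth_on (@G0 R) Y ->
  forall x, G0 x ->
    nabla (push_left a X) (push_left a Y) x = push_left a (nabla X Y) x /\
    nabla (push_right a X) (push_right a Y) x = push_right a (nabla X Y) x.

Definition is_kplus (R : realType)
    (g : form_field R 'M[R]_2) : Prop :=
  semi_riemannian (@G0 R) g /\
  forall u v x, G0 x -> g x (left_field u x) (left_field v x) = trace_form u v.

Definition is_nabla (R : realType)
    (nabla : connection_op 'M[R]_2) : Prop :=
  is_connection (@G0 R) nabla /\
  forall u v x, G0 x ->
    nabla (left_field u) (left_field v) x = left_field (u *m v) x.

(* Main.v *)
Require Import Defs.
From HB Require Import structures.
From mathcomp Require Import all_boot all_order all_algebra.
From mathcomp Require Import all_classical all_reals all_analysis.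
From mathcomp Require Import ring lra.

(** Left translations on [GL2] are restrictions of linear maps of the matrix
    space [E = 'M[R]_2]: the left-invariant field of [u] is [x |-> x *m u], and
    its ordinary derivative along [x *m w] is [x *m w *m u].  Hence the ordinary
    directional derivative [(X, Y) |-> D_X Y] of [E], restricted to the open set
    [G0], is a connection sending [(w+, u+)] to [(w *m u)+].  The fields of a
    basis of [E] form a global frame of [G0] ([left_field_span]) and a
    connection is determined by its values on a frame ([connection_eq_frame]),
    so every connection satisfying the defining property is the ordinary
    derivative ([is_nabla_unique]).  It is torsion free by definition of the
    bracket, flat by symmetry of second derivatives ([derive_comm],
    [field_deriv_flat]), and invariant under the linear maps [x |-> a *m x] and
    [x |-> x *m a].  In the same way the metric is
    [kplus x v w = \tr (x^-1 v x^-1 w)]; its index is [1] because the trace form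
    is negative on the antisymmetric line and positive on the symmetric
    hyperplane ([kplus_index]).

    For the ordinary derivative, [nabla df] is the second derivative of [f]
    ([log_det_hessian]).  The potential is [f = - ln det]: Jacobi's formula
    gives [D_w f = - \tr (x^-1 w)] ([derive_log_det]), and differentiating the
    inverse gives [D_v D_w f = \tr (x^-1 v x^-1 w)] ([derive2_log_det]).  The
    logarithm makes sense since [det], continuous and nonzero on the connected
    set [G0] and equal to [1] at the identity, is positive there
    ([G0_det_gt0]).

    The smoothness claims rest on stability of the C^k classes under sums,
    linear and bilinear maps and inversion of scalar functions, each proved by
    induction on [k] from the corresponding rule of differentiation. *)

Set Implicit Arguments.
Unset Strict Implicit.
Unset Printing Implicit Defensive.

Import Order.TTheory GRing.Theory Num.Theory.
Import numFieldNormedType.Exports.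

Local Open Scope classical_set_scope.
Local Open Scope ring_scope.

(** * Calculus of C^k maps *)

Section Locality.
Variables (R : realType) (V W : normedModType R).
Implicit Types (f g : V -> W) (x v : V) (M : set V).

(** Differentiability is local: [g - f] vanishes near [x], hence has the zero
    map as differential there. *)
Lemma near_eq_differentiable f g x :
  (\near x, f x = g x) -> differentiable f x -> differentiable g x.
Proof.
move=> fg df; have -> : g = f + (g - f) by rewrite addrC subrK.
apply: (@differentiableD _ _ _ f) => //.
pose z : {linear V -> W} := \0.
have zc : continuous z by move=> y; exact: cvg_cst.
have zE : (g - f) \o shift x = cst ((g - f) x) + z +o_ 0 id.
  apply/eqaddoP => _/posnumP[e].
  have : \forall y \near 0, f (y + x) = g (y + x).
    by rewrite (near_shift x) sub0r; near do rewrite /= subrK.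
  apply: filterS => y fgy.
  have fgx := nbhs_singleton fg.
  rewrite /= !fctE /= fgy fgx !subrr addr0 subr0 normr0 mulr_ge0//.
by apply/diff_locallyP; rewrite (diff_unique zc zE).
Unshelve. all: by end_near. Qed.

Lemma open_nearW M f g x : open M -> (forall y, M y -> f y = g y) -> M x ->
  \near x, f x = g x.
Proof.
by move=> oM fg Mx; near=> y; apply: fg; near: y; exact: open_nbhs_nbhs.
Unshelve. all: by end_near. Qed.

Lemma derive_open_eq M f g x v : open M -> (forall y, M y -> f y = g y) ->
  M x -> 'D_v f x = 'D_v g x.
Proof. by move=> oM fg Mx; apply/near_eq_derive/(open_nearW oM). Qed.

(** Derivatives on an open set only see the values there, which is what lets
    each closure lemma below replace a derivative by its formula and apply the
    induction hypothesis to that formula. *)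
Lemma Ck_on_eq M k f g : open M -> (forall y, M y -> f y = g y) ->
  Ck_on M k f -> Ck_on M k g.
Proof.
move=> oM; elim: k f g => [|k IHk] f g fg /= => [cf|[df Df]].
  move=> x Mx; rewrite /prop_for /continuous_at -(fg _ Mx).
  by apply: cvg_trans (cf _ Mx); apply: near_eq_cvg; exact: (open_nearW oM).
split=> [x Mx|v].
  by apply: near_eq_differentiable (df _ Mx); exact: (open_nearW oM).
by apply: IHk (Df v) => y My; exact: derive_open_eq My.
Qed.

Lemma Ck_onS M k f : Ck_on M k.+1 f -> Ck_on M k f.
Proof.
elim: k f => [|k IHk] f /= [df Df].
  by move=> x /df /differentiable_continuous.
by split=> // v; exact: (IHk _ (Df v)).
Qed.

Lemma Ck_on_cst M k (w : W) : Ck_on M k (fun=> w : W).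
Proof.
elim: k w => [|k IHk] w /=; first by move=> x _; exact: cvg_cst.
split=> [x _|v]; first exact: differentiable_cst.
by under eq_fun do rewrite derive_cst; exact: IHk.
Qed.

Lemma Ck_onD M k f g : open M ->
  Ck_on M k f -> Ck_on M k g -> Ck_on M k (fun x => f x + g x).
Proof.
move=> oM; elim: k f g => [|k IHk] f g /=.
  by move=> cf cg x Mx; apply: (@continuousD _ _ _ f g); [exact: cf|exact: cg].
move=> [df Df] [dg Dg]; split=> [x Mx|v].
  by apply: (@differentiableD _ _ _ f g); [exact: df|exact: dg].
apply: Ck_on_eq (IHk _ _ (Df v) (Dg v)) => // y My.
by rewrite (@deriveD _ _ _ f g)//; apply: diff_derivable; [exact: df|exact: dg].
Qed.

Lemma Ck_on_sum M k (I : Type) (r : seq I) (F : I -> V -> W) : open M ->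
  (forall i, Ck_on M k (F i)) -> Ck_on M k (fun x => \sum_(i <- r) F i x).
Proof.
move=> oM CF; elim: r => [|i r IHr].
  by under eq_fun do rewrite big_nil; exact: Ck_on_cst.
by under eq_fun do rewrite big_cons; exact: Ck_onD.
Qed.

Lemma smooth_on_differentiable M f x : smooth_on M f -> M x ->
  differentiable f x.
Proof. by move=> sf Mx; have [+ _] := sf 1; exact. Qed.

Lemma smooth_on_derive M f v : smooth_on M f -> smooth_on M ('D_v f).
Proof. by move=> sf k; have [_] := sf k.+1; exact. Qed.

End Locality.

(** * Linear and bilinear maps *)

Section LinearMaps.
Variables (R : realType).

Lemma derive_comp_linear (V V' W W' : normedModType R)
    (L : {linear V' -> V}) (L' : {linear W -> W'}) (f : V -> W) x v :
  continuous L -> continuous L' -> differentiable f (L x) ->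
  'D_v (L' \o f \o L) x = L' ('D_(L v) f (L x)).
Proof.
move=> cL cL' df.
have dL y := linear_differentiable y cL.
have dL' y := linear_differentiable y cL'.
have dL'f : differentiable (L' \o f) (L x) by exact: differentiable_comp.
rewrite (deriveE _ df) deriveE; last exact: differentiable_comp.
rewrite (diff_comp (dL x) dL'f) /= (diff_lin x cL).
by rewrite (diff_comp df (dL' _)) /= (diff_lin _ cL').
Qed.

Lemma Ck_on_comp_linear (V V' W W' : normedModType R) (M : set V') (N : set V)
    (L : {linear V' -> V}) (L' : {linear W -> W'}) k (f : V -> W) :
  open M -> continuous L -> continuous L' -> (forall x, M x -> N (L x)) ->
  Ck_on N k f -> Ck_on M k (L' \o f \o L).
Proof.
move=> oM cL cL' LN; elim: k f => [|k IHk] f /=.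
  move=> cf x Mx; apply: continuous_comp; first exact: cL.
  by apply: continuous_comp; [exact: cf (LN _ Mx)|exact: cL'].
move=> [df Df]; split=> [x Mx|v].
  apply: differentiable_comp; first exact: linear_differentiable.
  apply: differentiable_comp; first exact: df (LN _ Mx).
  exact: linear_differentiable.
apply: Ck_on_eq (IHk _ (Df (L v))) => // x Mx.
by rewrite (derive_comp_linear _ cL cL')//; exact: df (LN _ Mx).
Qed.

(** Matrix spaces are finite dimensional: expand along the basis [delta_mx]. *)
Lemma linear_mx_continuous m n (W : normedModType R)
    (f : {linear 'M[R]_(m.+1, n.+1) -> W}) : continuous f.
Proof.
have -> : (f : _ -> _) =
    fun A : 'M[R]_(m.+1, n.+1) => \sum_i \sum_j A i j *: f (delta_mx i j).
  apply/funext => A; rewrite [in LHS](matrix_sum_delta A) linear_sum.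
  apply: eq_bigr => i _; rewrite linear_sum.
  by apply: eq_bigr => j _; rewrite linearZ.
have entryZ i j :
    continuous (fun A : 'M[R]_(m.+1, n.+1) => A i j *: f (delta_mx i j)).
  move=> A; apply: (@continuous_comp _ _ _
    (fun A : 'M[R]_(m.+1, n.+1) => A i j) ( *:%R ^~ (f (delta_mx i j)))).
    exact: coord_continuous.
  exact: scalel_continuous.
apply: (continuous_big add_continuous) => i _.
by apply: (continuous_big add_continuous) => j _; exact: entryZ.
Qed.

End LinearMaps.

Section Bilinear.
Variables (R : realType).

Lemma bilinear_mx_continuous m n p q (W : normedModType R)
    (B : {bilinear 'M[R]_(m.+1, n.+1) -> 'M[R]_(p.+1, q.+1) -> W}) :
  continuous (fun x => B x.1 x.2).
Proof.
have -> : (fun x => B x.1 x.2) =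
    fun x => \sum_i \sum_j x.1 i j *: B (delta_mx i j) x.2.
  apply/funext => x; rewrite [in LHS](matrix_sum_delta x.1) linear_sumlz.
  apply: eq_bigr => i _; rewrite linear_sumlz; apply: eq_bigr => j _.
  by rewrite linearZl_LR.
pose EE := ('M[R]_(m.+1, n.+1) * 'M[R]_(p.+1, q.+1))%type.
have entryZ i j : continuous (fun x : EE => x.1 i j *: B (delta_mx i j) x.2).
  move=> x; apply: (@continuous_comp _ _ _
    (fun x : EE => (x.1 i j : R^o, B (delta_mx i j) x.2))
    (fun z => z.1 *: z.2)); last exact: scale_continuous.
  have c1 : {for x, continuous (fun x : EE => x.1 i j : R^o)}.
    apply: (@continuous_comp _ _ _ fst (fun A : 'M[R]_(m.+1, n.+1) => A i j)).
      exact: cvg_fst.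
    exact: coord_continuous.
  have c2 : {for x, continuous (fun x : EE => B (delta_mx i j) x.2)}.
    apply: (@continuous_comp _ _ _ snd (B (delta_mx i j))).
      exact: cvg_snd.
    exact: linear_mx_continuous.
  exact: cvg_pair c1 c2.
apply: (continuous_big add_continuous) => i _.
by apply: (continuous_big add_continuous) => j _; exact: entryZ.
Qed.

Section BilinearRule.
Variables (V U U' W : normedModType R) (B : {bilinear U -> U' -> W}).
Hypothesis cB : continuous (fun p => B p.1 p.2).

Lemma differentiable_bilinear (f : V -> U) (g : V -> U') x :
  differentiable f x -> differentiable g x ->
  differentiable (fun y => B (f y) (g y)) x.
Proof.
move=> df dg.
apply: (@differentiable_comp _ _ _ _
  (fun y => (f y, g y)) (fun p => B p.1 p.2)).
  exact: differentiable_pair.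
exact: differentiable_bilin.
Qed.

Lemma derive_bilinear (f : V -> U) (g : V -> U') x v :
  differentiable f x -> differentiable g x ->
  'D_v (fun y => B (f y) (g y)) x = B (f x) ('D_v g x) + B ('D_v f x) (g x).
Proof.
move=> df dg; rewrite deriveE; last exact: differentiable_bilinear.
rewrite (@diff_comp _ _ _ _ (fun y => (f y, g y)) (fun p => B p.1 p.2)).
- by rewrite diff_bilin//= diff_pair//= !deriveE.
- exact: differentiable_pair.
- exact: differentiable_bilin.
Qed.

(** The product rule splits a derivative of order [k.+1] into two products of
    factors of class [k]. *)
Lemma Ck_on_bilinear M k (f : V -> U) (g : V -> U') : open M ->
  Ck_on M k f -> Ck_on M k g -> Ck_on M k (fun x => B (f x) (g x)).
Proof.
move=> oM; elim: k f g => [|k IHk] f g.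
  move=> cf cg x Mx.
  apply: (@continuous_comp _ _ _ (fun x => (f x, g x)) (fun p => B p.1 p.2)).
    exact: cvg_pair (cf _ Mx) (cg _ Mx).
  exact: cB.
move=> Cf Cg; have Cf' := Ck_onS Cf; have Cg' := Ck_onS Cg.
case: Cf Cg => [df Df] [dg Dg]; split=> [x Mx|v].
  by apply: differentiable_bilinear; [exact: df|exact: dg].
have CB := Ck_onD oM (IHk _ _ Cf' (Dg v)) (IHk _ _ (Df v) Cg').
apply: Ck_on_eq CB => // x Mx.
by rewrite derive_bilinear//; [exact: df|exact: dg].
Qed.

End BilinearRule.

Section Scalars.
Variables (V : normedModType R).

(** Scaling, named so that it can carry a bilinear structure with the scalars
    seen as the normed module [R^o]. *)
Definition scale_map (W : normedModType R) (a : R^o) (w : W) : W := a *: w.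

Lemma scale_is_bilinear (W : normedModType R) :
  bilinear_for *:%R *:%R (@scale_map W).
Proof.
split=> [w|a] c x y; rewrite /scale_map/=; first by rewrite scalerDl scalerA.
by rewrite scalerDr !scalerA mulrC.
Qed.

HB.instance Definition _ (W : normedModType R) :=
  bilinear_isBilinear.Build R R^o W W *:%R *:%R (@scale_map W)
    (@scale_is_bilinear W).

Lemma derive_scale (W : normedModType R) (f : V -> R^o) (g : V -> W) x v :
  differentiable f x -> differentiable g x ->
  'D_v (fun y => f y *: g y) x = f x *: 'D_v g x + 'D_v f x *: g x.
Proof.
exact: (@derive_bilinear V _ _ _ (@scale_map W)
  scale_continuous).
Qed.

Lemma differentiable_scale (W : normedModType R) (f : V -> R^o) (g : V -> W) x :
  differentiable f x -> differentiable g x ->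
  differentiable (fun y => f y *: g y) x.
Proof.
exact: (@differentiable_bilinear V _ _ _ (@scale_map W)
  scale_continuous).
Qed.

Lemma Ck_on_scale (W : normedModType R) M k (f : V -> R^o) (g : V -> W) :
  open M -> Ck_on M k f -> Ck_on M k g -> Ck_on M k (fun x => f x *: g x).
Proof.
exact: (@Ck_on_bilinear V _ _ _ (@scale_map W)
  scale_continuous).
Qed.

(** [D_v (1/f) = - (1/f)^2 D_v f] involves [1/f] itself only to order [k], so
    the induction on [k] closes. *)
Lemma Ck_on_inv M k (f : V -> R^o) : open M -> (forall x, M x -> f x != 0) ->
  Ck_on M k f -> Ck_on M k (fun x => (f x)^-1 : R^o).
Proof.
move=> oM f0; elim: k => [|k IHk].
  by move=> cf x Mx; apply: cvgV; [exact: f0|exact: cf].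
move=> Cf; have Cf' := IHk (Ck_onS Cf).
case: Cf => [df Df]; split=> [x Mx|v].
  by apply: differentiableV; [exact: df|exact: f0].
have Cm1 := Ck_on_cst M k (-1 : R^o).
have CDf := Ck_on_scale oM (Ck_on_scale oM Cm1 (Ck_on_scale oM Cf' Cf')) (Df v).
apply: Ck_on_eq CDf => // x Mx.
have dfx := df _ Mx; have fx0 := f0 _ Mx.
rewrite [RHS]deriveE; last exact: differentiableV.
rewrite (diffV dfx fx0) deriveE//= /GRing.scale/= /GRing.scale/=.
by rewrite mulN1r expr2 invfM.
Qed.

End Scalars.

End Bilinear.

Section Sums.
Variables (R : realType) (V W : normedModType R).

Lemma differentiable_bigsum (I : Type) (r : seq I) (F : I -> V -> W) x :
  (forall i, differentiable (F i) x) ->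
  differentiable (fun y => \sum_(i <- r) F i y) x.
Proof.
move=> dF; elim: r => [|i r IHr].
  by under eq_fun do rewrite big_nil; exact: differentiable_cst.
by under eq_fun do rewrite big_cons; exact: (@differentiableD _ _ _ (F i)).
Qed.

Lemma derive_bigsum (I : Type) (r : seq I) (F : I -> V -> W) x v :
  (forall i, differentiable (F i) x) ->
  'D_v (fun y => \sum_(i <- r) F i y) x = \sum_(i <- r) 'D_v (F i) x.
Proof.
move=> dF; elim: r => [|i r IHr].
  by under eq_fun do rewrite big_nil; rewrite derive_cst big_nil.
under eq_fun do rewrite big_cons; rewrite big_cons -IHr.
rewrite (@deriveD _ _ _ (F i) (fun y => \sum_(i <- r) F i y))//.
  exact: diff_derivable.
exact/diff_derivable/differentiable_bigsum.
Qed.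

Lemma smooth_on_sum M (I : Type) (r : seq I) (F : I -> V -> W) : open M ->
  (forall i, smooth_on M (F i)) -> smooth_on M (fun x => \sum_(i <- r) F i x).
Proof. by move=> oM sF k; apply: Ck_on_sum => // i; exact: sF. Qed.

Lemma smooth_on_scale M (f : V -> R^o) (g : V -> W) : open M ->
  smooth_on M f -> smooth_on M g -> smooth_on M (fun x => f x *: g x).
Proof. by move=> oM sf sg k; exact: Ck_on_scale. Qed.

Lemma smooth_on_cst M (w : W) : smooth_on M (fun _ : V => w).
Proof. by move=> k; exact: Ck_on_cst. Qed.

Lemma smooth_on_eq M (f g : V -> W) : open M -> (forall y, M y -> f y = g y) ->
  smooth_on M f -> smooth_on M g.
Proof. by move=> oM fg sf k; exact: Ck_on_eq (sf k). Qed.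

Lemma smooth_onD M (f g : V -> W) : open M ->
  smooth_on M f -> smooth_on M g -> smooth_on M (fun x => f x + g x).
Proof. by move=> oM sf sg k; exact: Ck_onD. Qed.

Lemma smooth_on_linear (W' : normedModType R) (M : set V) (L : {linear W -> W'})
    (f : V -> W) : open M -> continuous L ->
  smooth_on M f -> smooth_on M (fun x => L (f x)).
Proof.
move=> oM cL sf k.
exact: (@Ck_on_comp_linear _ _ _ _ _ M M idfun L k f oM
  (fun x => cvg_id) cL (fun x Mx => Mx)).
Qed.

Lemma derive_linear (W' : normedModType R) (L : {linear W -> W'})
    (f : V -> W) x v : continuous L -> differentiable f x ->
  'D_v (fun y => L (f y)) x = L ('D_v f x).
Proof.
move=> cL df.
exact: (@derive_comp_linear _ _ _ _ _ idfun L f x v (fun x => cvg_id) cL df).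
Qed.

Lemma smooth_onN M (f : V -> W) : open M ->
  smooth_on M f -> smooth_on M (fun x => - f x).
Proof.
move=> oM sf.
apply: (@smooth_on_linear _ M (@GRing.opp W : {linear W -> W})) => //.
exact: opp_continuous.
Qed.

End Sums.

Section IdentityAndLogarithm.
Variables (R : realType) (V : normedModType R).

Lemma smooth_on_id (M : set V) : smooth_on M (fun x => x).
Proof.
case=> [|k]; first by move=> x _; exact: cvg_id.
split=> [x _|v]; first exact: (@ex_diff _ _ _ _ _ id).
by under eq_fun do rewrite derive_id; exact: Ck_on_cst.
Qed.

Lemma deriveN_fun (W : normedModType R) (f : V -> W) x v : differentiable f x ->
  'D_v (fun y => - f y) x = - 'D_v f x.
Proof. by move=> df; apply: deriveN; exact: diff_derivable. Qed.

Let lnR : R^o -> R^o := @ln R.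

Lemma differentiable_lnR (r : R) : 0 < r -> differentiable lnR r.
Proof. by move=> /is_derive1_ln[dl _]; exact/derivable1_diffP. Qed.

Lemma diff_lnR (r : R) (h : R^o) : 0 < r -> 'd lnR r h = r^-1 * h.
Proof.
move=> r0; have dl := differentiable_lnR r0; have [_ lE] := is_derive1_ln r0.
have E : 'd lnR r (1 : R^o) = r^-1 by rewrite -deriveE.
have -> : h = h *: (1 : R^o) by rewrite [RHS]mulr1.
by rewrite linearZ/= E [LHS]mulrC [h *: _]mulr1.
Qed.

Lemma differentiable_ln (f : V -> R^o) x : differentiable f x -> 0 < f x ->
  differentiable (fun y => ln (f y) : R^o) x.
Proof.
move=> df fx0; apply: (@differentiable_comp _ _ _ _ f lnR) => //.
exact: differentiable_lnR.
Qed.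

Lemma derive_ln (f : V -> R^o) x v : differentiable f x -> 0 < f x ->
  'D_v (fun y => ln (f y) : R^o) x = (f x)^-1 * 'D_v f x.
Proof.
move=> df fx0; rewrite deriveE; last exact: differentiable_ln.
rewrite (@diff_comp _ _ _ _ f lnR)//=; last exact: differentiable_lnR.
by rewrite diff_lnR// deriveE.
Qed.

End IdentityAndLogarithm.

Section MatrixEntries.
Variables (R : realType).

(** The coefficient map, named so that it can carry a linear structure. *)
Definition mx_entry m n (i : 'I_m) (j : 'I_n) (A : 'M[R]_(m, n)) : R^o := A i j.

Lemma mx_entry_is_linear m n i j : linear (@mx_entry m n i j).
Proof. by move=> a A B; rewrite /mx_entry !mxE. Qed.

HB.instance Definition _ m n i j := GRing.isLinear.Build R 'M[R]_(m, n) R^o _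
  (@mx_entry m n i j) (@mx_entry_is_linear m n i j).

Variables (V : normedModType R) (m n : nat).
Implicit Types (f : V -> 'M[R]_(m.+1, n.+1)) (M : set V).

Lemma smooth_on_entry M f i j : open M -> smooth_on M f ->
  smooth_on M (fun x => f x i j : R^o).
Proof.
move=> oM; apply: (@smooth_on_linear _ _ _ _ _ (mx_entry i j)) => //.
exact: linear_mx_continuous.
Qed.

Lemma derive_entry f x v i j : differentiable f x ->
  'D_v (fun y => f y i j : R^o) x = 'D_v f x i j.
Proof.
apply: (@derive_linear _ _ _ _ (mx_entry i j)).
exact: linear_mx_continuous.
Qed.

End MatrixEntries.

Section MatrixProduct.
Variables (R : realType) (V : normedModType R) (m n p : nat).
Implicit Types (f : V -> 'M[R]_(m.+1, n.+1)) (g : V -> 'M[R]_(n.+1, p.+1)).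

Let B : {bilinear 'M[R]_(m.+1, n.+1) -> 'M[R]_(n.+1, p.+1) ->
    'M[R]_(m.+1, p.+1)} := @mulmx R m.+1 n.+1 p.+1.

Lemma smooth_on_mulmx (M : set V) f g : open M ->
  smooth_on M f -> smooth_on M g -> smooth_on M (fun x => f x *m g x).
Proof.
move=> oM sf sg k.
exact: (Ck_on_bilinear (@bilinear_mx_continuous _ _ _ _ _ _ B)).
Qed.

Lemma derive_mulmx f g x v : differentiable f x -> differentiable g x ->
  'D_v (fun y => f y *m g y) x = f x *m 'D_v g x + 'D_v f x *m g x.
Proof.
exact: (derive_bilinear (@bilinear_mx_continuous _ _ _ _ _ _ B)).
Qed.

Lemma mxtrace_continuous : continuous (fun A : 'M[R]_n.+1 => \tr A : R^o).
Proof. exact: (@linear_mx_continuous R n n R^o (@mxtrace R n.+1)). Qed.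

Lemma smooth_on_tr (M : set V) (f : V -> 'M[R]_n.+1) : open M ->
  smooth_on M f -> smooth_on M (fun x => \tr (f x) : R^o).
Proof.
move=> oM; apply: (@smooth_on_linear _ _ _ _ _ (@mxtrace R n.+1)) => //.
exact: mxtrace_continuous.
Qed.

Lemma derive_tr (f : V -> 'M[R]_n.+1) x v : differentiable f x ->
  'D_v (fun y => \tr (f y) : R^o) x = \tr ('D_v f x).
Proof.
apply: (@derive_linear _ _ _ _ (@mxtrace R n.+1)).
exact: mxtrace_continuous.
Qed.

End MatrixProduct.

(** * Symmetry of second derivatives *)

Section MixedPartials.
Variables (R : realType) (V : normedModType R).
Implicit Types (f : V -> R^o) (x v w : V).

Lemma MVT_direction f x v (s : R) : 0 < s ->
  (forall t, 0 <= t <= s -> differentiable f (x + t *: v)) ->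
  exists2 t, 0 <= t <= s & f (x + s *: v) - f x = s * 'D_v f (x + t *: v).
Proof.
move=> s0 df.
pose g (t : R) : R := f (x + t *: v).
pose l (t : R) := x + t *: v.
have dl (t : R) : is_diff t l ( *:%R ^~ v).
  by rewrite /l; apply: is_diff_eq; rewrite add0r.
have dg (t : R) : t \in `[0, s] -> is_derive t 1 g ('D_v f (x + t *: v)).
  rewrite in_itv /= => ts; have dfl := df _ ts.
  have dlt := dl t; have dlt' : differentiable l t by exact: ex_diff.
  have dgt : differentiable g t by exact: (@differentiable_comp _ _ _ _ l f).
  apply: DeriveDef; first exact: diff_derivable.
  rewrite deriveE// (@diff_comp _ _ _ _ l f)//= diff_val scale1r.
  by rewrite deriveE.
pose dgf (t : R) : R := 'D_v f (x + t *: v).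
have dgE (t : R) : t \in `]0, s[ -> is_derive t 1 g (dgf t).
  by move/subset_itv_oo_cc; exact: dg.
have cg : {within `[0, s], continuous g}.
  by apply: derivable_within_continuous => t /dg dgt; exact: ex_derive.
have [t ts E] := MVT_segment (ltW s0) dgE cg.
exists t; first by move: ts; rewrite in_itv.
by move: E; rewrite /g /dgf scale0r addr0 subr0 mulrC.
Qed.

Lemma derive_translate f x v w :
  'D_v (fun y => f (y + w)) x = 'D_v f (x + w).
Proof. by rewrite /derive /=; under eq_fun do rewrite -addrA. Qed.

(** The mean value theorem along [v] for the difference [y |-> f (y + s *: w) -
    f y], then along [w] for ['D_v f]. *)
Lemma second_difference f x v w (s d : R) : 0 < s -> s * (`|v| + `|w|) < d ->
  (forall y, ball x d y -> differentiable f y) ->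
  (forall y, ball x d y -> differentiable ('D_v f) y) ->
  exists2 y, ball x d y &
    f (x + s *: v + s *: w) - f (x + s *: v) - (f (x + s *: w) - f x)
    = s ^+ 2 * 'D_w ('D_v f) y.
Proof.
move=> s0 sd df df'.
have inball a b : 0 <= a <= s -> 0 <= b <= s -> ball x d (x + a *: v + b *: w).
  move=> /andP[a0 as_] /andP[b0 bs]; rewrite -ball_normE /= -addrA opprD addNKr.
  rewrite normrN (le_lt_trans (ler_normD _ _))// (le_lt_trans _ sd)// !normrZ.
  by rewrite !ger0_norm// mulrDr lerD// ler_wpM2r.
have s0s : 0 <= s <= s by rewrite ltW /=.
have z0s : 0 <= (0 : R) <= s by rewrite lexx ltW.
pose g y := f (y + s *: w) - f y.
have dsh (y : V) : differentiable (fun y => y + s *: w) y.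
  by apply: differentiableD.
have dfs y : ball x d (y + s *: w) ->
    differentiable (fun y => f (y + s *: w)) y.
  move=> By.
  apply: (@differentiable_comp _ _ _ _ (fun y => y + s *: w) f) => //.
  exact: df.
have dg t : 0 <= t <= s -> differentiable g (x + t *: v).
  move=> ts; apply: (@differentiableB _ _ _ (fun y => f (y + s *: w)) f).
    by apply: dfs; exact: inball.
  apply: df; rewrite -[X in ball _ _ X]addr0 -[X in _ + X](scale0r w).
  exact: inball.
have [t ts gE] := MVT_direction s0 dg.
have [|t' ts'] := @MVT_direction ('D_v f) (x + t *: v) w s s0.
  by move=> t' ts'; apply: df'; exact: inball.
move=> E; exists (x + t *: v + t' *: w); first exact: inball.
rewrite -[LHS]/(g (x + s *: v) - g x) gE expr2 -mulrA -E.
congr (_ * _); have Bt : ball x d (x + t *: v).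
  by rewrite -[X in ball _ _ X]addr0 -[X in _ + X](scale0r w); exact: inball.
have Bts := inball _ _ ts s0s.
rewrite (@deriveB _ _ _ (fun y => f (y + s *: w)) f); last 2 first.
- by apply: diff_derivable; exact: dfs.
- by apply: diff_derivable; exact: df.
by rewrite derive_translate.
Qed.

Lemma dist_triangle_half (p q r e : R) :
  `|p - r| < e / 2 -> `|q - r| < e / 2 -> `|p - q| <= e.
Proof.
move=> pr qr; have -> : p - q = (p - r) - (q - r) by ring.
apply: le_trans (ler_normB _ _) _; lra.
Qed.

(** The second difference of [f] along [v] and [w] is symmetric in [v] and [w];
    so for small [s] it is [s ^+ 2] times a value near [x] of either mixed
    derivative, and both are continuous at [x]. *)
Lemma derive_comm f M x v w : open M -> Ck_on M 2 f -> M x ->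
  'D_v ('D_w f) x = 'D_w ('D_v f) x.
Proof.
move=> oM [df Df] Mx; apply/eqP; rewrite -subr_eq0 -normr_le0.
apply/ler_addgt0Pl => e e0; rewrite addr0.
have [_ Dv] := Df v; have [_ Dw] := Df w.
have e20 : 0 < e / 2 by rewrite divr_gt0.
have near_lt (g : V -> R^o) : {for x, continuous g} ->
    nbhs x (fun y => `|g x - g y| < e / 2).
  by move=> /cvgrPdist_lt; exact.
have nv := near_lt _ (Dv w _ Mx); have nw := near_lt _ (Dw v _ Mx).
have nM : nbhs x M by exact: open_nbhs_nbhs.
have FF : Filter (nbhs x) by exact: nbhs_filter.
have nvwM := @filterI _ _ FF _ _ (@filterI _ _ FF _ _ nv nw) nM.
have [d /= d0 dB] := (nbhs_ballP _ _).1 nvwM.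
(* small enough for the parallelogram spanned by [s *: v] and [s *: w] at [x] to
   lie in the ball, also when [v] and [w] vanish *)
pose s := d / 2 / (`|v| + `|w| + 1).
have n1 : 0 < `|v| + `|w| + 1 by rewrite ltr_wpDl// addr_ge0.
have s0 : 0 < s by rewrite !divr_gt0.
have sd : s * (`|v| + `|w|) < d.
  rewrite /s mulrAC ltr_pdivrMr//.
  have : 0 <= d * (`|v| + `|w|) by rewrite mulr_ge0 ?addr_ge0// ltW.
  move: d0; rewrite /=; lra.
have dfB y : ball x d y -> differentiable f y by move=> /dB[_ /df].
have dDB u y : ball x d y -> differentiable ('D_u f) y.
  by move=> /dB[_ My]; exact: (Df u).1.
have [y1 /dB[[h1 _] _] E1] := second_difference s0 sd dfB (dDB v).
have sd' : s * (`|w| + `|v|) < d by rewrite (addrC `|w|).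
have [y2 /dB[[_ h2] _] E2] := second_difference s0 sd' dfB (dDB w).
(* the two second differences are the same sum of four values of [f] *)
have E : 'D_w ('D_v f) y1 = 'D_v ('D_w f) y2.
  apply: (@mulfI _ (s ^+ 2)); first by rewrite expf_neq0// gt_eqF.
  have swap : x + s *: w + s *: v = x + s *: v + s *: w by rewrite addrAC.
  have sub4 (p q r t : R) : p - q - (r - t) = p - r - (q - t) by ring.
  by apply: etrans (esym E1) _; apply: etrans E2; rewrite swap; exact: sub4.
by rewrite -E in h2; exact: dist_triangle_half h2 h1.
Qed.

Lemma derive_comm_mx m n (f : V -> 'M[R]_(m.+1, n.+1)) M x v w :
  open M -> smooth_on M f -> M x ->
  'D_v ('D_w f) x = 'D_w ('D_v f) x.
Proof.
move=> oM sf Mx; apply/matrixP => i j.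
have D2 u u' : 'D_u ('D_u' f) x i j = 'D_u ('D_u' (fun y => f y i j : R^o)) x.
  rewrite -derive_entry; last first.
    by apply: smooth_on_differentiable Mx; exact: smooth_on_derive.
  apply: derive_open_eq Mx => // y My.
  by rewrite derive_entry//; exact: smooth_on_differentiable My.
have s2 := smooth_on_entry i j oM sf 2.
apply: etrans (D2 v w) _; apply: etrans (esym (D2 w v)).
exact: derive_comm Mx.
Qed.

End MixedPartials.

(** * The connection given by the directional derivative *)

Section FieldDerivative.
Variables (R : realType) (m n : nat) (W : normedModType R).
Local Notation E := 'M[R]_(m.+1, n.+1).
Variable M : set E.
Hypothesis oM : open M.
Implicit Types (X Y : E -> E) (f : E -> W).

Lemma derive_basis f x v : differentiable f x ->
  'D_v f x =
  \sum_(p : 'I_m.+1 * 'I_n.+1) v p.1 p.2 *: 'D_(delta_mx p.1 p.2) f x.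
Proof.
move=> df; rewrite deriveE// [in LHS](matrix_sum_delta v) linear_sum.
rewrite -(pair_bigA _ (fun i j => v i j *: 'D_(delta_mx i j) f x))/=.
apply: eq_bigr => i _; rewrite linear_sum; apply: eq_bigr => j _.
by rewrite linearZ/= deriveE.
Qed.

Lemma smooth_on_field_deriv X f : smooth_on M X -> smooth_on M f ->
  smooth_on M (field_deriv X f).
Proof.
move=> sX sf; apply: (@smooth_on_eq _ _ _ _ (fun x =>
  \sum_(p : 'I_m.+1 * 'I_n.+1)
    (X x p.1 p.2 : R^o) *: 'D_(delta_mx p.1 p.2) f x)) => //.
  move=> x Mx; rewrite /field_deriv derive_basis//.
  exact: smooth_on_differentiable Mx.
apply: smooth_on_sum => // p; apply: smooth_on_scale => //.
  exact: smooth_on_entry.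
exact: smooth_on_derive.
Qed.

(** The second term keeps the direction [Y x] constant: it is the second
    derivative of [f], the only part that survives in curvature and Hessian. *)
Lemma derive_field_deriv Y f x v : smooth_on M Y -> smooth_on M f -> M x ->
  'D_v (field_deriv Y f) x = 'D_('D_v Y x) f x + 'D_v ('D_(Y x) f) x.
Proof.
move=> sY sf Mx.
have df y : M y -> differentiable f y by exact: smooth_on_differentiable.
have dDf u : differentiable ('D_u f) x.
  by apply: smooth_on_differentiable Mx; exact: smooth_on_derive.
have dY : differentiable Y x by exact: smooth_on_differentiable Mx.
have dYe (p : 'I_m.+1 * 'I_n.+1) :
    differentiable (fun y => Y y p.1 p.2 : R^o) x.
  by apply: smooth_on_differentiable Mx; exact: smooth_on_entry.
rewrite (@derive_open_eq _ _ _ M _ (fun x => \sum_(p : 'I_m.+1 * 'I_n.+1)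
    (Y x p.1 p.2 : R^o) *: 'D_(delta_mx p.1 p.2) f x)) //; last first.
  by move=> y My; rewrite /field_deriv derive_basis//; exact: df.
rewrite derive_bigsum; last by move=> p; exact: differentiable_scale.
rewrite [X in _ = _ + X](@derive_open_eq _ _ _ M _ (fun y =>
  \sum_(p : 'I_m.+1 * 'I_n.+1)
    (Y x p.1 p.2 : R^o) *: 'D_(delta_mx p.1 p.2) f y)) //; last first.
  by move=> y My; rewrite derive_basis//; exact: df.
rewrite derive_bigsum; last by move=> p; apply: differentiable_scale.
rewrite derive_basis; last exact: df.
rewrite -big_split; apply: eq_bigr => p _ /=.
rewrite !derive_scale// derive_cst scale0r addr0 addrC.
by rewrite derive_entry.
Qed.

End FieldDerivative.

Section StandardConnection.
Variables (R : realType) (m n : nat).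
Local Notation E := 'M[R]_(m.+1, n.+1).
Variable M : set E.
Hypothesis oM : open M.

Lemma field_deriv_is_connection : is_connection M (@field_deriv R E E).
Proof.
have dM (W : normedModType R) (f : E -> W) x :
    smooth_on M f -> M x -> differentiable f x.
  exact: smooth_on_differentiable.
split.
- move=> X X' Y Y' sX sY XX' YY' x Mx; rewrite /field_deriv -XX'//.
  exact: derive_open_eq Mx.
- by move=> X Y sX sY; exact: smooth_on_field_deriv.
- move=> f X X' Y sf sX sX' sY x Mx; rewrite /field_deriv.
  have dY := dM _ _ _ sY Mx.
  by rewrite !deriveE// linearP.
- move=> X Y Y' sX sY sY' x Mx; rewrite /field_deriv.
  by rewrite (@deriveD _ _ _ Y Y')//; apply: diff_derivable; exact: dM Mx.
- move=> f X Y sf sX sY x Mx; rewrite /field_deriv.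
  by rewrite derive_scale 1?addrC//; exact: dM Mx.
Qed.

Lemma lie_bracket_smooth (X Y : E -> E) : smooth_on M X -> smooth_on M Y ->
  smooth_on M (lie_bracket X Y).
Proof.
move=> sX sY; apply: smooth_onD => //; last apply: smooth_onN => //.
all: exact: smooth_on_field_deriv.
Qed.

(** By [derive_field_deriv], [D_X D_Y Z - D_Y D_X Z] is [D_(D_X Y - D_Y X) Z] up
    to the difference of two second derivatives of [Z], which are equal. *)
Lemma field_deriv_flat : flat M (@field_deriv R E E).
Proof.
move=> X Y Z sX sY sZ x Mx.
have dZ : differentiable Z x by exact: smooth_on_differentiable Mx.
have cancel (a b c h : E) : a - b = c -> a + h - (b + h) - c = 0.
  by move=> <-; rewrite opprD addrACA subrr addr0 subrr.
have XY := derive_field_deriv oM (X x) sY sZ Mx.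
have YX := etrans (derive_field_deriv oM (Y x) sX sZ Mx)
  (congr1 (+%R _) (derive_comm_mx (Y x) (X x) oM sZ Mx)).
apply: etrans (congr2 (fun a b => a - b - _) XY YX) _; apply: cancel.
by rewrite /lie_bracket /field_deriv !(deriveE _ dZ) linearB.
Qed.

Section Agree.
Variable nabla : connection_op E.
Hypothesis cn : is_connection M nabla.
Hypothesis nablaE : forall X Y : E -> E, smooth_on M X -> smooth_on M Y ->
  forall x, M x -> nabla X Y x = field_deriv X Y x.

Lemma torsion_free_agree : torsion_free M nabla.
Proof. by move=> X Y sX sY x Mx; rewrite !nablaE. Qed.

Lemma flat_agree : flat M nabla.
Proof.
move=> X Y Z sX sY sZ x Mx.
have sB := lie_bracket_smooth sX sY.
have sn U U' : smooth_on M U -> smooth_on M U' -> smooth_on M (nabla U U').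
  exact: (connection_smooth cn).
have nn U U' : smooth_on M U -> smooth_on M U' ->
    nabla U (nabla U' Z) x = field_deriv U (field_deriv U' Z) x.
  move=> sU sU'; rewrite nablaE//; last exact: sn.
  by apply: derive_open_eq Mx => // y My; exact: nablaE.
by rewrite !nn// nablaE//; exact: field_deriv_flat.
Qed.

End Agree.

End StandardConnection.

(** * Connections and global frames *)

Section Frame.
Variables (R : realType) (V : normedModType R) (M : set V).
Hypothesis oM : open M.
Variables (I : finType) (e : I -> V -> V).
Hypothesis se : forall i, smooth_on M (e i).

Lemma connection_sumr nabla (X : V -> V) (c : I -> V -> R^o) x :
  is_connection M nabla -> smooth_on M X ->
  (forall i, smooth_on M (c i)) -> M x ->
  nabla X (fun y => \sum_i c i y *: e i y) x =
  \sum_i (field_deriv X (c i) x *: e i x + c i x *: nabla X (e i) x).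
Proof.
move=> cn sX sc Mx; elim: (index_enum I) => [|i r IHr].
  under eq_fun do rewrite big_nil; rewrite big_nil.
  have s0 := smooth_on_cst M (0 : V).
  (* [nabla X 0] is twice itself *)
  have := connection_addr cn sX s0 s0 Mx; under eq_fun do rewrite addr0.
  by move/eqP; rewrite -subr_eq subrr => /eqP.
have sce j : smooth_on M (fun y => c j y *: e j y) by exact: smooth_on_scale.
under eq_fun do rewrite big_cons.
rewrite (connection_addr cn)//; last exact: smooth_on_sum.
by rewrite big_cons IHr (connection_leibniz cn).
Qed.

Lemma connection_suml nabla (Y : V -> V) (c : I -> V -> R^o) x :
  is_connection M nabla -> smooth_on M Y ->
  (forall i, smooth_on M (c i)) -> M x ->
  nabla (fun y => \sum_i c i y *: e i y) Y x = \sum_i c i x *: nabla (e i) Y x.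
Proof.
move=> cn sY sc Mx; elim: (index_enum I) => [|i r IHr].
  under eq_fun do rewrite big_nil; rewrite big_nil.
  have s0 := smooth_on_cst M (0 : V).
  (* [nabla 0 Y] is twice itself *)
  have := connection_linearl cn (smooth_on_cst M (1 : R^o)) s0 s0 sY Mx.
  under eq_fun do rewrite scaler0 addr0.
  by rewrite scale1r => /eqP; rewrite -subr_eq subrr => /eqP.
have sce j : smooth_on M (fun y => c j y *: e j y) by exact: smooth_on_scale.
under eq_fun do rewrite big_cons.
rewrite (connection_linearl cn)//; last exact: smooth_on_sum.
by rewrite big_cons IHr.
Qed.

(** The Leibniz rule and linearity in the first argument reduce [nabla X Y] to
    the fields [nabla (e i) (e j)]; the derivatives of the coefficients that
    appear are the same for both connections. *)
Lemma connection_eq_frame (nabla nabla' : connection_op V) :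
  is_connection M nabla -> is_connection M nabla' ->
  (forall Y : V -> V, smooth_on M Y -> exists2 c : I -> V -> R^o,
     forall i, smooth_on M (c i) &
     forall x, M x -> Y x = \sum_i c i x *: e i x) ->
  (forall i j x, M x -> nabla (e i) (e j) x = nabla' (e i) (e j) x) ->
  forall X Y : V -> V, smooth_on M X -> smooth_on M Y ->
  forall x, M x -> nabla X Y x = nabla' X Y x.
Proof.
move=> cn cn' span agree X Y sX sY x Mx.
have [a sa aE] := span _ sX; have [b sb bE] := span _ sY.
pose Yb y := \sum_i b i y *: e i y; pose Xa y := \sum_i a i y *: e i y.
rewrite (connection_ext cn (X' := X) (Y' := Yb))//.
rewrite (connection_ext cn' (X' := X) (Y' := Yb))//.
rewrite !connection_sumr//; apply: eq_bigr => j _; congr (_ + _ *: _).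
rewrite (connection_ext cn (X' := Xa) (Y' := e j))//.
rewrite (connection_ext cn' (X' := Xa) (Y' := e j))//.
by rewrite !connection_suml//; apply: eq_bigr => i _; rewrite agree.
Qed.

End Frame.

(** * Determinant, inverse and the potential *)

Section Determinant.
Variable R : realType.
Local Notation E := 'M[R]_2.
Implicit Types (x y u v w a : E).

Lemma det_mx2 x : \det x = x 0 0 * x 1 1 - x 0 1 * x 1 0.
Proof.
rewrite (expand_det_row _ 0) !big_ord_recl big_ord0 addr0 /cofactor !det_mx11.
rewrite !mxE/=.
have -> : lift 0 0 = 1 :> 'I_2 by apply/val_inj.
have -> : lift 1 0 = 0 :> 'I_2 by apply/val_inj.
by rewrite addn0 expr0 mul1r addn1 expr1 mulN1r mulrN.
Qed.

(** Cayley-Hamilton in dimension 2, which shows that the adjugate is linear. *)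
Lemma adj_mx2 x : \adj x = \tr x *: 1%:M - x.
Proof.
have ordP (i : 'I_2) : i = 0 \/ i = 1.
  by case: i => -[|[|//]] ip; [left|right]; exact: val_inj.
have l0 : lift 0 0 = 1 :> 'I_2 by apply/val_inj.
have l1 : lift 1 0 = 0 :> 'I_2 by apply/val_inj.
apply/matrixP => i j; have [->|->] := ordP i; have [->|->] := ordP j;
  rewrite /mxtrace !mxE /cofactor det_mx11 !mxE !big_ord_recl big_ord0;
  rewrite ?l0 ?l1/=;
  rewrite !(addn0, add0n, addn1, expr0, expr1) ?sqrrN ?expr1n; ring.
Qed.

Lemma det_smooth (M : set E) : open M -> smooth_on M (fun x => \det x : R^o).
Proof.
move=> oM; have sid := smooth_on_id M.
under eq_fun do rewrite det_mx2.
by apply: smooth_onD => //; last apply: smooth_onN => //;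
  apply: smooth_on_scale => //; exact: smooth_on_entry.
Qed.

(** Jacobi's formula. *)
Lemma derive_det x v : 'D_v (fun y => \det y : R^o) x = \tr (\adj x *m v).
Proof.
under eq_fun do rewrite det_mx2.
have de i j (y : E) : differentiable (fun y : E => y i j : R^o) y.
  exact: differentiable_coord.
have dee i j k l (y : E) : differentiable (fun y : E => y i j * y k l : R^o) y.
  exact: differentiable_scale.
rewrite (@deriveB _ _ _ (fun y : E => y 0 0 * y 1 1 : R^o)
  (fun y : E => y 0 1 * y 1 0 : R^o)); last 2 first.
- exact: diff_derivable.
- exact: diff_derivable.
have D i j k l : 'D_v (fun y : E => y i j * y k l : R^o) x =
    x i j * v k l + v i j * x k l.
  rewrite (@derive_scale _ _ _ (fun y : E => y i j) (fun y : E => y k l))//.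
  by rewrite !(@derive_entry _ _ _ _ id) ?derive_id.
rewrite !D /mxtrace !big_ord_recl big_ord0 addr0 !mxE !big_ord_recl.
rewrite !big_ord0 !mxE /cofactor !det_mx11 !mxE/=.
have -> : lift 0 0 = 1 :> 'I_2 by apply/val_inj.
have -> : lift 1 0 = 0 :> 'I_2 by apply/val_inj.
rewrite !(addn0, add0n, addn1, expr0, expr1) sqrrN expr1n.
ring.
Qed.

Variable M : set E.
Hypotheses (oM : open M) (MU : forall x, M x -> x \in unitmx).

Lemma smooth_on_invmx : smooth_on M (@invmx R 2).
Proof.
apply: (@smooth_on_eq _ _ _ M
  (fun x => (\det x)^-1 *: (\tr x *: 1%:M - x))) => //.
  by move=> x /MU xU; rewrite /invmx xU adj_mx2.
have sid := @smooth_on_id R E M.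
apply: smooth_on_scale => //.
  move=> k; apply: Ck_on_inv => //; last exact: det_smooth.
  by move=> x /MU; rewrite unitmxE unitfE.
apply: smooth_onD => //; last exact: smooth_onN.
apply: smooth_on_scale => //; first exact: smooth_on_tr.
exact: smooth_on_cst.
Qed.

(** Differentiate [y *m invmx y = 1%:M]. *)
Lemma derive_invmx x v : M x ->
  'D_v (@invmx R 2) x = - (invmx x *m v *m invmx x).
Proof.
move=> Mx; have xU := MU Mx.
have dI := smooth_on_differentiable smooth_on_invmx Mx.
have : 'D_v (fun y : E => y *m invmx y) x = 0.
  rewrite (@derive_open_eq _ _ _ M _ (fun=> 1%:M)) ?derive_cst// => y /MU yU.
  exact: mulmxV.
rewrite (@derive_mulmx _ _ _ _ _ id) ?derive_id// => /eqP.
rewrite addr_eq0 => /eqP E.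
by rewrite -[LHS](mulKmx xU) E mulmxN mulmxA.
Qed.

Lemma differentiable_det x : M x -> differentiable (fun x => \det x : R^o) x.
Proof. by apply: smooth_on_differentiable; exact: det_smooth. Qed.

Hypothesis detM : forall x, M x -> 0 < \det x.

Definition log_det_potential x : R^o := - ln (\det x).

Lemma differentiable_log_det x : M x -> differentiable log_det_potential x.
Proof.
move=> Mx; apply: (@differentiableN _ _ _ (fun y : E => ln (\det y) : R^o)).
exact: (differentiable_ln (differentiable_det Mx) (detM Mx)).
Qed.

Lemma derive_log_det x v : M x ->
  'D_v log_det_potential x = - \tr (invmx x *m v).
Proof.
move=> Mx; have dd := differentiable_det Mx; have dx := detM Mx.
rewrite (deriveN_fun _ (differentiable_ln dd dx)) (derive_ln _ dd dx).
rewrite derive_det.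
by rewrite /invmx MU// -scalemxAl mxtraceZ.
Qed.

(** The first derivatives no longer involve the logarithm, and are smooth
    because the inverse is. *)
Lemma smooth_on_log_det : smooth_on M log_det_potential.
Proof.
case=> [|k].
  by move=> x /differentiable_log_det /differentiable_continuous.
split=> [x /differentiable_log_det//|v].
have : smooth_on M (fun x => - \tr (invmx x *m v) : R^o).
  apply: smooth_onN => //; apply: smooth_on_tr => //.
  apply: smooth_on_mulmx => //; first exact: smooth_on_invmx.
  exact: smooth_on_cst.
by move=> /(_ k); apply: Ck_on_eq => // x Mx; rewrite derive_log_det.
Qed.

Lemma derive2_log_det x v w : M x ->
  'D_v ('D_w log_det_potential) x = \tr (invmx x *m v *m (invmx x *m w)).
Proof.
move=> Mx.
rewrite (@derive_open_eq _ _ _ M _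
  (fun x => - \tr (invmx x *m w)))//; last first.
  by move=> y My; exact: derive_log_det.
have dI := smooth_on_differentiable smooth_on_invmx Mx.
have sw : smooth_on M (fun x => invmx x *m w).
  apply: smooth_on_mulmx => //; first exact: smooth_on_invmx.
  exact: smooth_on_cst.
have dIw := smooth_on_differentiable sw Mx.
have dt := smooth_on_differentiable (smooth_on_tr oM sw) Mx.
rewrite (deriveN_fun _ dt) (derive_tr _ dIw) (derive_mulmx _ dI) ?derive_cst//.
by rewrite mulmx0 add0r derive_invmx// mulNmx linearN opprK !mulmxA.
Qed.

End Determinant.

(** * The identity component *)

Section LocalConnectedness.
Variables (R : realType) (V : normedModType R).

(** A ball is the union of the segments joining its centre to its points. *)
Lemma ball_connected (x : V) (r : R) : connected (ball x r).
Proof.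
have [r0|r0] := ltP 0 r; last first.
  have -> : ball x r = set0; last exact: connected0.
  rewrite -subset0 => y; rewrite -ball_normE /= => yr.
  by have := lt_le_trans yr r0; rewrite ltNge normr_ge0.
pose seg y := (fun t : R => x + t *: (y - x)) @` `[0, 1].
have -> : ball x r = \bigcup_(y in ball x r) seg y.
  apply/seteqP; split=> [y Bxy|z [y Bxy [t /=]]].
    exists y => //; exists 1; rewrite /= ?in_itv/= ?ler01 ?lexx//.
    by rewrite scale1r addrC subrK.
  rewrite in_itv/= => /andP[t0 t1] <-.
  move: Bxy; rewrite -ball_normE /= => Bxy.
  rewrite opprD addNKr normrN normrZ ger0_norm// distrC.
  by apply: le_lt_trans Bxy; rewrite ler_piMl.
apply: bigcup_connected.
  exists x => y _; exists 0; rewrite /= ?in_itv/= ?ler01 ?lexx//.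
  by rewrite scale0r addr0.
move=> y _; apply: connected_continuous_connected.
  exact: segment_connected.
apply: continuous_subspaceT => t.
apply: (@continuousD _ _ _ (fun=> x) (fun t : R => t *: (y - x))).
  exact: cvg_cst.
exact: scalel_continuous.
Qed.

(** Components of an open set are open because balls are connected. *)
Lemma open_connected_component (A : set V) x : open A ->
  open (connected_component A x).
Proof.
move=> oA; rewrite openE => y Cy.
have Ay := connected_component_sub Cy.
have /nbhs_ballP[r /= r0 rA] : nbhs y A by exact: open_nbhs_nbhs.
apply/nbhs_ballP; exists r => //= z yz.
apply: (connected_component_trans Cy).
apply: connected_component_max yz => //; first exact: ballxx.
exact: ball_connected.
Qed.

End LocalConnectedness.

Section IdentityComponent.
Variable R : realType.
Local Notation E := 'M[R]_2.
Local Notation G := (@G0 R).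
Implicit Types (x y u v w a : E).

Lemma det_continuous : continuous (fun x => \det x : R^o).
Proof.
move=> x; apply: differentiable_continuous.
exact: (differentiable_det openT).
Qed.

Lemma GL2_open : open (@GL2 R).
Proof.
rewrite (_ : @GL2 R = (fun x : E => \det x : R^o) @^-1` [set r | r != 0]).
  by apply: open_comp => [x _|]; [exact: det_continuous|exact: open_neq].
by apply/seteqP; split=> x /=; rewrite /GL2/= unitmxE unitfE.
Qed.

Lemma G0_open : open G.
Proof. exact: open_connected_component GL2_open. Qed.

Lemma G0_unit x : G x -> x \in unitmx.
Proof. exact: connected_component_sub. Qed.

Lemma G0_1 : G 1%:M.
Proof. by apply: connected_component_refl; exact: unitmx1. Qed.

Lemma G0_det_gt0 x : G x -> 0 < \det x.
Proof.
move=> Gx; pose D (y : E) : R^o := \det y.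
have /connected_intervalP iD : connected (D @` G).
  apply: connected_continuous_connected; first exact: component_connected.
  exact/continuous_subspaceT/det_continuous.
rewrite ltNge; apply/negP => dx.
have [y Gy y0] : (D @` G) 0.
  apply: (iD (\det x) 1); first by exists x.
    by exists 1%:M; [exact: G0_1|exact: det1].
  by rewrite dx ler01.
rewrite /D in y0; by have := G0_unit Gy; rewrite unitmxE y0 unitr0.
Qed.

(** The image [f @` G] is connected, hence inside [G] as soon as it meets it.
    For translations [f] this makes [G] a subgroup. *)
Lemma G0_translate (f : E -> E) y : continuous f ->
  (forall x, x \in unitmx -> f x \in unitmx) ->
  G y -> G (f y) -> forall x, G x -> G (f x).
Proof.
move=> cf fU Gy Gfy x Gx; apply: (connected_component_trans Gfy).
have fGU : f @` G `<=` @GL2 R by move=> _ [z /G0_unit zU <-]; exact: fU.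
have fGc : connected (f @` G).
  apply: connected_continuous_connected; first exact: component_connected.
  exact: continuous_subspaceT.
by apply: (connected_component_max _ fGU fGc); [exists y|exists x].
Qed.

Lemma mulmx_continuous a : continuous (mulmx a : E -> E).
Proof. exact: linear_mx_continuous. Qed.

Lemma mulmxr_continuous a : continuous (mulmxr a : E -> E).
Proof. exact: linear_mx_continuous. Qed.

Lemma G0_mul a x : G a -> G x -> G (a *m x).
Proof.
move=> Ga; apply: (@G0_translate (mulmx a) 1%:M) G0_1 _ _ => [|z zU|].
- exact: mulmx_continuous.
- by rewrite unitmx_mul zU (G0_unit Ga).
- by rewrite mulmx1.
Qed.

Lemma G0_inv a : G a -> G (invmx a).
Proof.
move=> Ga; have aU := G0_unit Ga; rewrite -[invmx a]mulmx1.
apply: (@G0_translate (mulmx (invmx a)) a) Ga _ _ G0_1 => [|z zU|].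
- exact: mulmx_continuous.
- by rewrite unitmx_mul unitmx_inv aU.
- by rewrite mulVmx//; exact: G0_1.
Qed.

End IdentityComponent.

(** * The bi-invariant connection *)

Section InvariantConnection.
Variable R : realType.
Local Notation E := 'M[R]_2.
Local Notation G := (@G0 R).
Implicit Types (x y u v w a : E).

Lemma left_field_smooth (M : set E) u : open M -> smooth_on M (left_field u).
Proof.
move=> oM; apply: (@smooth_on_mulmx _ _ _ _ _ _ id) => //.
  exact: smooth_on_id.
exact: smooth_on_cst.
Qed.

(** The coefficients are the entries of [invmx x *m Y x], the value of [Y]
    carried back to the identity by left translation. *)
Lemma left_field_span (Y : E -> E) : smooth_on G Y ->
  exists2 c : 'I_2 * 'I_2 -> E -> R^o, forall p, smooth_on G (c p) &
  forall x, G x -> Y x = \sum_p c p x *: left_field (delta_mx p.1 p.2) x.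
Proof.
move=> sY; have oG := @G0_open R.
have sI := smooth_on_invmx oG (@G0_unit R).
exists (fun p x => (invmx x *m Y x) p.1 p.2) => [p|x Gx].
  by apply: smooth_on_entry => //; exact: smooth_on_mulmx.
rewrite -[LHS](mulKVmx (G0_unit Gx)).
rewrite [in LHS](matrix_sum_delta (invmx x *m Y x)) mulmx_sumr.
rewrite -(pair_bigA _ (fun i j =>
  (invmx x *m Y x) i j *: left_field (delta_mx i j) x))/=.
apply: eq_bigr => i _; rewrite mulmx_sumr.
by apply: eq_bigr => j _; rewrite -scalemxAr.
Qed.

Lemma field_deriv_left_field u v x :
  field_deriv (left_field u) (left_field v) x = left_field (u *m v) x.
Proof.
rewrite /field_deriv (@derive_linear _ _ _ _ (mulmxr v) id)//; last first.
  exact: mulmxr_continuous.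
by rewrite derive_id /= /left_field mulmxA.
Qed.

Lemma is_nabla_field_deriv : is_nabla (@field_deriv R E E).
Proof.
split; first exact: field_deriv_is_connection (@G0_open R).
by move=> u v x _; exact: field_deriv_left_field.
Qed.

Lemma is_nabla_unique (nabla : connection_op E) : is_nabla nabla ->
  forall X Y : E -> E, smooth_on G X -> smooth_on G Y ->
  forall x, G x -> nabla X Y x = field_deriv X Y x.
Proof.
move=> [cn nE]; have oG := @G0_open R.
apply: (connection_eq_frame oG
  (e := fun p : 'I_2 * 'I_2 => left_field (delta_mx p.1 p.2))) => //.
- by move=> p; exact: left_field_smooth.
- exact: field_deriv_is_connection.
- exact: left_field_span.
- by move=> p q x Gx; rewrite nE// field_deriv_left_field.
Qed.

(** The directional derivative commutes with linear automorphisms of the ambient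
    matrix space, and translations by [a] are such. *)
Lemma is_nabla_biinvariant (nabla : connection_op E) : is_nabla nabla ->
  biinvariant_connection nabla.
Proof.
move=> nN a X Y Ga sX sY x Gx; have oG := @G0_open R; have aU := G0_unit Ga.
have GV y : G y -> G (invmx a *m y) by apply: G0_mul; exact: G0_inv.
have GV' y : G y -> G (y *m invmx a).
  by move=> Gy; apply: G0_mul => //; exact: G0_inv.
have sl Z : smooth_on G Z -> smooth_on G (push_left a Z).
  move=> sZ k; apply: (@Ck_on_comp_linear _ _ _ _ _ G G
    (mulmx (invmx a)) (mulmx a)) => //.
  - exact: mulmx_continuous.
  - exact: mulmx_continuous.
have sr Z : smooth_on G Z -> smooth_on G (push_right a Z).
  move=> sZ k; apply: (@Ck_on_comp_linear _ _ _ _ _ G G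
    (mulmxr (invmx a)) (mulmxr a)) => //.
  - exact: mulmxr_continuous.
  - exact: mulmxr_continuous.
have nE := is_nabla_unique nN.
split; rewrite nE//; [|exact: sl|exact: sl| |exact: sr|exact: sr].
- rewrite /push_left nE//; last exact: GV.
  rewrite /field_deriv.
  rewrite (@derive_comp_linear _ _ _ _ _ (mulmx (invmx a)) (mulmx a))/=.
  + by rewrite mulKmx.
  + exact: mulmx_continuous.
  + exact: mulmx_continuous.
  + by apply: smooth_on_differentiable sY _; exact: GV.
- rewrite /push_right nE//; last exact: GV'.
  rewrite /field_deriv.
  rewrite (@derive_comp_linear _ _ _ _ _ (mulmxr (invmx a)) (mulmxr a))/=.
  + by rewrite mulmxK.
  + exact: mulmxr_continuous.
  + exact: mulmxr_continuous.
  + by apply: smooth_on_differentiable sY _; exact: GV'.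
Qed.

End InvariantConnection.

(** * The bi-invariant metric *)

Section Metric.
Variable R : realType.
Local Notation E := 'M[R]_2.
Local Notation G := (@G0 R).
Implicit Types (x y u v w a : E).

Definition kplus x v w : R := \tr (invmx x *m v *m (invmx x *m w)).

Lemma kplus_scalar x v : scalar (kplus x v).
Proof.
by move=> c w w'; rewrite /kplus !(mulmxDr, linearD) -!scalemxAr linearZ.
Qed.

Lemma kplus_sym x v w : kplus x v w = kplus x w v.
Proof. exact: mxtrace_mulC. Qed.

Lemma kplus_left x u v : x \in unitmx ->
  kplus x (x *m u) (x *m v) = trace_form u v.
Proof. by move=> xU; rewrite /kplus !mulKmx. Qed.

Lemma trace_form_delta u i j : trace_form u (delta_mx j i) = u i j.
Proof.
rewrite /trace_form -(mul_delta_mx (0 : 'I_1)) mulmxA mxtrace_mulC mulmxA.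
rewrite -colE -rowE /mxtrace.
by rewrite big_ord_recl big_ord0 addr0 !mxE.
Qed.

Lemma kplus_nondegenerate x v : x \in unitmx ->
  (forall w, kplus x v w = 0) -> v = 0.
Proof.
move=> xU v0; rewrite -[v](mulKVmx xU).
suff -> : invmx x *m v = 0 by rewrite mulmx0.
apply/matrixP => i j.
rewrite [RHS]mxE -trace_form_delta -(v0 (x *m delta_mx j i)).
by rewrite /kplus mulKmx.
Qed.

Lemma trace_form_sq u :
  trace_form u u = u 0 0 ^+ 2 + u 1 1 ^+ 2 + u 0 1 * u 1 0 *+ 2.
Proof.
rewrite /trace_form /mxtrace !big_ord_recl big_ord0 addr0 !mxE.
rewrite !big_ord_recl !big_ord0.
have -> : lift 0 0 = 1 :> 'I_2 by apply/val_inj.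
rewrite !addr0; ring.
Qed.

(** Up to translation by [x] this is the trace form, whose value at [(u, u)] is
    given by [trace_form_sq].  It is negative on the line of antisymmetric [u]
    and nonnegative on the symmetric ones, which are the kernel of one linear
    form [s]; a negative definite subspace meets this kernel trivially, so [s]
    embeds it into a line. *)
Lemma kplus_index x : x \in unitmx -> has_index (kplus x) 1.
Proof.
move=> xU.
have negE v : kplus x v v = trace_form (invmx x *m v) (invmx x *m v) by [].
pose J : E := delta_mx 0 1 - delta_mx 1 0.
split.
  exists <[x *m J]>%VS.
    move=> v /vlineP[c ->] cJ0.
    have c0 : c != 0 by apply: contraNneq cJ0 => ->; rewrite scale0r.
    rewrite negE -scalemxAr mulKmx// trace_form_sq !mxE/=.
    have : 0 < c ^+ 2 by rewrite exprn_even_gt0.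
    nra.
  rewrite dim_vline; suff -> : x *m J != 0 by [].
  apply/eqP => xJ0; have : J 0 1 = 0.
    by rewrite -[J](mulKmx xU) xJ0 mulmx0 mxE.
  by rewrite !mxE/= subr0 => /eqP; rewrite oner_eq0.
move=> W nW.
(* vanishes exactly when [invmx x *m v] is symmetric *)
pose s v : R^o := (invmx x *m v) 0 1 - (invmx x *m v) 1 0.
have sL : linear s.
  move=> c v w; rewrite /s mulmxDr -scalemxAr.
  set p := invmx x *m v; set q := invmx x *m w; rewrite !mxE.
  by rewrite [c *: (_ : R^o)]mulrBr addrACA -opprD.
pose sM := GRing.isLinear.Build _ _ _ _ _ sL.
pose sl : {linear E -> R^o} := HB.pack s sM.
have ker0 : (W :&: lker (linfun sl))%VS = 0%VS.
  apply/eqP; rewrite -subv0; apply/subvP => v.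
  rewrite memv_cap memv_ker lfunE/= memv0.
  move=> /andP[vW /eqP sv0]; apply/negPn/negP => v0; have := nW _ vW v0.
  rewrite negE trace_form_sq; move: sv0 => /eqP; rewrite /s subr_eq0 => /eqP ->.
  rewrite ltNge => /negP; apply.
  by rewrite !addr_ge0 ?sqr_ge0// -expr2 mulrn_wge0// sqr_ge0.
rewrite -(limg_ker_dim (linfun sl) W) ker0 dimv0 add0n.
by rewrite (leq_trans (dimvS (subvf _)))// dimvf.
Qed.

Lemma is_kplus_kplus : is_kplus kplus.
Proof.
have oG := @G0_open R; have sI := smooth_on_invmx oG (@G0_unit R).
split; last by move=> u v x Gx; rewrite kplus_left// G0_unit.
split.
- by move=> x _; exact: kplus_scalar.
- by move=> x _; exact: kplus_sym.
- by move=> x /G0_unit xU v; exact: kplus_nondegenerate.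
- move=> v w; apply: smooth_on_tr => //.
  by do 2!apply: smooth_on_mulmx => //; exact: smooth_on_cst.
- by exists 1%N => x /G0_unit; exact: kplus_index.
Qed.

Lemma is_kplus_unique (g : form_field R E) x : is_kplus g -> G x ->
  g x = kplus x.
Proof.
move=> [_ gE] Gx; have xU := G0_unit Gx; apply/funext => v; apply/funext => w.
by rewrite -[v](mulKVmx xU) -[w](mulKVmx xU) [LHS]gE// kplus_left.
Qed.

Lemma is_kplus_biinvariant (g : form_field R E) : is_kplus g ->
  biinvariant_metric g.
Proof.
move=> gk a x Ga Gx v w; have aU := G0_unit Ga; have xU := G0_unit Gx.
rewrite !(is_kplus_unique gk)//; [|exact: G0_mul..].
have invmxM (b y : E) : b \in unitmx -> y \in unitmx ->
    invmx (b *m y) = invmx y *m invmx b.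
  exact: (@invrM E).
rewrite /kplus; split; rewrite invmxM// !mulmxA.
  by rewrite !(mulmxKV aU).
by rewrite (mulmxK aU) mxtrace_mulC !mulmxA (mulmxV aU) mul1mx.
Qed.

End Metric.

(** * The Hessian structure *)

(** As [nabla] is the directional derivative, the first-order terms of
    [derive_field_deriv] cancel and [nabla df] is the second derivative of the
    potential. *)
Lemma log_det_hessian (R : realType) (g : form_field R 'M[R]_2)
    (nabla : connection_op 'M[R]_2) :
  is_kplus g -> is_nabla nabla ->
  hessian_potential (@G0 R) nabla g (@G0 R) (@log_det_potential R).
Proof.
move=> gk nN; have oG := @G0_open R.
have sf := smooth_on_log_det oG (@G0_unit R) (@G0_det_gt0 R).
split=> // X Y sX sY x Gx; rewrite (is_kplus_unique gk Gx).
rewrite /field_deriv (is_nabla_unique nN sX sY Gx).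
rewrite -[X in _ = X - _]/('D_(X x) (field_deriv Y (@log_det_potential R)) x).
rewrite (derive_field_deriv oG _ sY sf Gx) addrAC subrr add0r.
by rewrite (derive2_log_det oG (@G0_unit R) (@G0_det_gt0 R)).
Qed.

Theorem theorem4 (R : realType) :
  [/\ (exists g : form_field R 'M[R]_2, is_kplus g),
      (exists nabla : connection_op 'M[R]_2, is_nabla nabla) &
      forall (g : form_field R 'M[R]_2) (nabla : connection_op 'M[R]_2),
        is_kplus g -> is_nabla nabla ->
        [/\ lorentzian (@G0 R) g /\ biinvariant_metric g,
            [/\ flat (@G0 R) nabla, torsion_free (@G0 R) nabla &
                biinvariant_connection nabla],
            local_hessian (@G0 R) nabla g &
            global_hessian (@G0 R) nabla g]].
Proof.
split; first by exists (@kplus R); exact: is_kplus_kplus.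
  by exists (@field_deriv R _ _); exact: is_nabla_field_deriv.
move=> g nabla gk nN; have oG := @G0_open R.
have nE := is_nabla_unique nN; have cn := nN.1.
have nflat : flat (@G0 R) nabla by exact: flat_agree.
have ntf : torsion_free (@G0 R) nabla by exact: torsion_free_agree.
have fm : flat_metric_manifold (@G0 R) nabla g by split=> //; exact: gk.1.
have H := log_det_hessian gk nN.
split.
- split; last exact: is_kplus_biinvariant.
  split=> // [|x Gx]; first exact: gk.1.
  by rewrite (is_kplus_unique gk Gx); apply: kplus_index; exact: G0_unit.
- by split=> //; exact: is_nabla_biinvariant.
- by split=> // x Gx; exists (@G0 R), (@log_det_potential R); split.
- by split=> //; exists (@log_det_potential R).
Qed.
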